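(* Let $t$ be a positive integer and let $G$ be a connected simple graph of order $n\geq 7t+1$ with minimum degree $\delta(G)\geq t$. If $q(G)\geq q\big(K_t\vee(K_{n-2t}\cup tK_1)\big)$, then $G$ has a spanning tree with leaf distance at least four.
   Context: $q(G)$ denotes the largest eigenvalue of the signless Laplacian matrix $Q(G)=D(G)+A(G)$, where $D(G)$ is the diagonal matrix of vertex degrees and $A(G)$ the adjacency matrix. $K_m$ is the complete graph on $m$ vertices, $tK_1$ is $t$ isolated vertices, $\cup$ is disjoint union, and $G_1\vee G_2$ is the join (disjoint union plus all edges between $V(G_1)$ and $V(G_2)$). The leaf distance of a tree is the minimum distance in the tree between two distinct leaves (vertices of degree one). *)

(* Defs.v *)
From mathcomp Require Import all_boot all_order all_algebra.
From mathcomp Require polyrcf complex.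
From mathcomp Require Import boolp classical_sets reals.

Set Implicit Arguments.
Unset Strict Implicit.
Unset Printing Implicit Defensive.

Import Order.TTheory GRing.Theory Num.Theory.

Record sgraph (V : finType) := SGraph {
  adj : rel V;
  adj_sym : symmetric adj;
  adj_irrefl : irreflexive adj
}.

Section Graph.
Variables (V : finType) (G : sgraph V).

Definition deg (x : V) : nat := #|[set y | adj G x y]|.

(* The default value #|V| of the minimum exceeds every degree, so it is
   irrelevant as soon as V is nonempty. *)
Definition min_deg : nat := \big[minn/#|V|]_(x : V) deg x.

Definition connected : Prop :=
  (0 < #|V|)%N /\ forall x y, connect (adj G) x y.

(* Every edge x -- y gives the ucycle [:: x; y]; the cycles in the
   graph-theoretic sense are the ucycles with at least three vertices. *)
Definition acyclic : Prop :=
  forall c : seq V, ucycle (adj G) c -> (size c <= 2)%N.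

Definition is_tree : Prop := connected /\ acyclic.

Definition walk (k : nat) (x y : V) : bool :=
  [exists p : k.-tuple V, path (adj G) x p && (last x p == y)].

(* Distances in a connected graph are smaller than #|V|; the default value
   #|V| is only taken when y is not reachable from x. *)
Definition dist (x y : V) : nat :=
  \big[minn/#|V|]_(k < #|V| | walk k x y) k.

Definition leaf (x : V) : bool := deg x == 1.

(* Since dist x y <= #|V|, this is the exact minimum as soon as there are two
   distinct leaves, hence for every tree with at least two vertices. *)
Definition leaf_dist : nat :=
  \big[minn/#|V|]_(p : V * V | [&& leaf p.1, leaf p.2 & p.1 != p.2])
     dist p.1 p.2.

End Graph.

Definition spanning_tree (V : finType) (G T : sgraph V) : Prop :=
  is_tree T /\ subrel (adj T) (adj G).

Section Constructions.

Lemma complete_sym m : symmetric (fun x y : 'I_m => x != y).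
Proof. by move=> x y; rewrite eq_sym. Qed.

Lemma complete_irrefl m : irreflexive (fun x y : 'I_m => x != y).
Proof. by move=> x; rewrite eqxx. Qed.

(* K_m *)
Definition complete (m : nat) : sgraph 'I_m :=
  SGraph (@complete_sym m) (@complete_irrefl m).

(* m K_1 *)
Definition edgeless (m : nat) : sgraph 'I_m :=
  @SGraph 'I_m (fun _ _ => false) (fun _ _ => erefl) (fun _ => erefl).

Variables (V1 V2 : finType) (G1 : sgraph V1) (G2 : sgraph V2).

Definition sum_adj (cross : bool) (x y : V1 + V2) : bool :=
  match x, y with
  | inl a, inl b => adj G1 a b
  | inr a, inr b => adj G2 a b
  | _, _ => cross
  end.

Lemma sum_adj_sym cross : symmetric (sum_adj cross).
Proof. by move=> [a|a] [b|b] //=; rewrite adj_sym. Qed.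

Lemma sum_adj_irrefl cross : irreflexive (sum_adj cross).
Proof. by move=> [a|a] /=; rewrite adj_irrefl. Qed.

Definition disjoint_union : sgraph (V1 + V2)%type :=
  SGraph (sum_adj_sym false) (sum_adj_irrefl false).

Definition join : sgraph (V1 + V2)%type :=
  SGraph (sum_adj_sym true) (sum_adj_irrefl true).

End Constructions.

Local Open Scope ring_scope.

Section SignlessLaplacian.
Variables (R : realType) (V : finType) (G : sgraph V).

Definition deg_mx : 'M[R]_#|V| := diag_mx (\row_i (deg G (enum_val i))%:R).

Definition adj_mx : 'M[R]_#|V| :=
  \matrix_(i, j) (adj G (enum_val i) (enum_val j))%:R.

Definition signless_laplacian : 'M[R]_#|V| := deg_mx + adj_mx.

End SignlessLaplacian.

(* The supremum of the spectrum; for a symmetric matrix of positive order it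
   is an eigenvalue, see largest_eigenvalueP. *)
Definition largest_eigenvalue (R : realType) (n : nat) (A : 'M[R]_n) : R :=
  sup [set a : R | eigenvalue A a]%classic.

Definition q_index (R : realType) (V : finType) (G : sgraph V) : R :=
  largest_eigenvalue (signless_laplacian R G).

Section LargestEigenvalue.
Import polyrcf complex.
Variables (R : realType) (n : nat).
Implicit Type A : 'M[R]_n.

Lemma sym_eigenvalue_exists A :
  (0 < n)%N -> A^T = A -> exists a, eigenvalue A a.
Proof.
move=> n0 symA.
pose C : numClosedFieldType := complex R.
pose f : {rmorphism R -> C} := real_complex R.
pose B := map_mx f A.
have /closed_rootP[z rz] : size (char_poly B) != 1%N.
  by rewrite size_char_poly; case: (n) n0.
have /eigenvalueP[v vB v0] : eigenvalue B z by rewrite eigenvalue_root_char.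
pose w := map_mx (@Num.conj C) v.
have BC : map_mx (@Num.conj C) B = B.
  apply/matrixP=> i j; rewrite !mxE; apply: conj_Creal.
  by apply/complex_realP; exists (A i j).
have BT : B^T = B by rewrite map_trmx symA.
have wB : w *m B = z^* *: w by rewrite -{1}BC -map_mxM vB map_mxZ.
pose s := (v *m w^T) 0 0.
have s0 : s != 0.
  apply: contraNneq v0; rewrite /s mxE => /psumr_eq0P h.
  apply/eqP/matrixP=> i j; rewrite ord1 [RHS]mxE.
  have /eqP : v 0 j * w^T j 0 = 0.
    by apply: h => // k _; rewrite !mxE mul_conjC_ge0.
  by rewrite !mxE mul_conjC_eq0 => /eqP.
have zs : z * s = z^* * s.
  have -> : z * s = (v *m B *m w^T) 0 0 by rewrite vB -scalemxAl [RHS]mxE.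
  by rewrite -mulmxA -{1}BT -trmx_mul wB linearZ /= -scalemxAr mxE.
have /complex_realP[a za] : z \is Num.real.
  by rewrite CrealE; apply/eqP; apply: (mulIf s0).
exists a; move: rz; rewrite za eigenvalue_root_char /B -map_char_poly.
by rewrite (fmorph_root f).
Qed.

Lemma largest_eigenvalueP A : (0 < n)%N -> A^T = A ->
  eigenvalue A (largest_eigenvalue A) /\
  forall a, eigenvalue A a -> a <= largest_eigenvalue A.
Proof.
move=> n0 symA.
have [a0 Ea0] := sym_eigenvalue_exists n0 symA.
have maxP (s : seq R) : s != [::] -> exists2 m, m \in s & {in s, forall x, x <= m}.
  elim: s => // x [|y s] IH _.
    by exists x; rewrite ?mem_head // => z; rewrite inE => /eqP->.
  have [//|m ms mP] := IH; have [xm|mx] := leP x m.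
    exists m; first by rewrite inE ms orbT.
    by move=> z; rewrite inE => /predU1P[->//|/mP].
  exists x; rewrite ?mem_head // => z; rewrite inE => /predU1P[->//|/mP zm].
  exact: le_trans zm (ltW mx).
have p0 : char_poly A != 0 by rewrite monic_neq0 ?char_poly_monic.
have eqE a : eigenvalue A a = (a \in rootsR (char_poly A)).
  by rewrite eigenvalue_root_char -(roots_on_rootsR p0 a) /=.
have [|m ms mP] := maxP (rootsR (char_poly A)).
  by apply: contraTneq Ea0 => h; rewrite eqE h.
have mub : ubound [set a : R | eigenvalue A a]%classic m.
  by move=> a /=; rewrite eqE => /mP.
have Em : eigenvalue A m by rewrite eqE.
have -> : largest_eigenvalue A = m.
  apply/eqP; rewrite eq_le; apply/andP; split.
    by apply: ge_sup => //; exists m.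
  by apply: ub_le_sup => //; exists m.
by split.
Qed.

End LargestEigenvalue.

Lemma signless_laplacian_sym (R : realType) (V : finType) (G : sgraph V) :
  (signless_laplacian R G)^T = signless_laplacian R G.
Proof.
rewrite /signless_laplacian linearD /= tr_diag_mx; congr (_ + _).
by apply/matrixP => i j; rewrite !mxE adj_sym.
Qed.

(* Main.v *)
Require Import Defs.
From mathcomp Require Import all_boot all_order all_algebra reals boolp.
From mathcomp Require Import zify lra ring.

Set Implicit Arguments.
Unset Strict Implicit.
Unset Printing Implicit Defensive.

Import Order.TTheory GRing.Theory Num.Theory.

(** A graph [G] satisfying the hypotheses is shown to have a Hamiltonian path,
    whose leaf distance is [n - 1].  If it has none, Chvatal's degree sequence
    theorem, applied to the cone over [G], gives [s >= t] with [2 s + 2 <= n]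
    such that [s + 1] vertices have degree at most [s] and [n - s] vertices have
    degree at most [n - s - 2].  The Collatz-Wielandt bound with a test vector
    taking three values, largest on the [s] remaining vertices, only depends on
    these degree bounds, and gives [q(G) < x] as soon as the characteristic
    polynomial [P_s] of the quotient matrix of [K_s v (K_(n-2s) U s K_1)] is
    nonnegative at some [x >= 2 n - 2 s - 2].  Take for [x] a root of [P_t] with
    [x >= 2 n - 2 t - 2]; it is an eigenvalue of the extremal graph, and
    [P_s - P_t] is [s - t] times a factor which is nonnegative because
    [n >= 7 t + 1]. *)

(** * Chvatal's degree sequence condition for Hamiltonian cycles *)

Section Chvatal.
Local Open Scope nat_scope.

Lemma mem_full_uniq (V : finType) (s : seq V) x :
  uniq s -> size s = #|V| -> x \in s.
Proof.
move=> Us szs; have sub z : z \in s -> z \in enum V by rewrite mem_enum.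
have [|_ ->] := uniq_min_size Us sub; first by rewrite -cardE szs.
by rewrite mem_enum.
Qed.

(** This is the usual notion from three vertices on, the range in which [chvatal] is stated. *)
Definition hamiltonian (V : finType) (G : sgraph V) : Prop :=
  exists2 c : seq V, ucycle (adj G) c & size c = #|V|.

Section AddEdge.
Variables (V : finType) (G : sgraph V) (u v : V) (uv : u != v).

Definition add_edge_adj (x y : V) : bool :=
  [|| adj G x y, (x == u) && (y == v) | (x == v) && (y == u)].

Lemma add_edge_sym : symmetric add_edge_adj.
Proof.
by move=> x y; rewrite /add_edge_adj adj_sym [X in _ || X]orbC [(y == v) && _]andbC
  [(y == u) && _]andbC.
Qed.

Lemma add_edge_irrefl : irreflexive add_edge_adj.
Proof.
move=> x; rewrite /add_edge_adj adj_irrefl /=.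
by apply/negbTE; apply: contraNN uv => /orP[] /andP[/eqP<- /eqP<-].
Qed.

Definition add_edge : sgraph V := SGraph add_edge_sym add_edge_irrefl.

Lemma deg_add_edge x : deg G x <= deg add_edge x.
Proof. by apply/subset_leq_card/subsetP => y; rewrite !inE /= /add_edge_adj => ->. Qed.

Lemma add_edge_path x p :
  u \notin x :: p -> path add_edge_adj x p = path (adj G) x p.
Proof.
elim: p x => //= y p IH x; rewrite inE negb_or => /andP[ux uyp].
rewrite IH //; congr (_ && _); rewrite /add_edge_adj.
move: uyp; rewrite inE negb_or => /andP[uy _].
by rewrite eq_sym (negbTE ux) [y == u]eq_sym (negbTE uy) andbF !orbF.
Qed.

End AddEdge.

(** Ore's crossing argument: the path successors of the neighbours of the last vertex [v] are not
    adjacent to [u], since otherwise two chords would turn the path into a Hamiltonian cycle. The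
    two disjoint sets both miss [u]. *)
Lemma deg_sum_ham_path (V : finType) (G : sgraph V) (u : V) (p : seq V) :
    path (adj G) u p -> uniq (u :: p) -> size (u :: p) = #|V| ->
    ~ hamiltonian G ->
  deg G u + deg G (last u p) < #|V|.
Proof.
move=> Gp Up szp nham; set v := last u p.
have inp z : z \in u :: p by apply: mem_full_uniq.
pose B := next (u :: p) @: [set y | adj G v y].
have cB : #|B| = deg G v.
  by rewrite card_imset //; apply: can_inj (prev_next Up).
have nxtE p1 p2 x : p = p1 ++ x :: p2 -> next (u :: p) (last u p1) = x.
  move=> pE; rewrite next_nth inp.
  have -> : index (last u p1) (u :: p) = size p1.
    rewrite pE -cat_cons index_cat mem_last.
    have U1 : uniq (u :: p1).
      by move: Up; rewrite pE -cat_cons cat_uniq => /andP[].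
    by rewrite (last_nth u) index_uniq.
  by rewrite pE nth_cat ltnn subnn.
have AB0 : [disjoint [set x | adj G u x] & B].
  rewrite -setI_eq0; apply/eqP/setP => x; rewrite in_set0 !inE.
  apply/negbTE/negP => /andP[ux /imsetP[y]]; rewrite inE => vy xE.
  move: (inp y) vy xE Gp Up szp nxtE; rewrite /v; case/splitPl => p1 p2 <-.
  rewrite last_cat cat_path; case: p2 => [|x' p2] /=.
    by rewrite adj_irrefl.
  move=> vy xE /and3P[P1 _ P2] Up szp nxtE.
  rewrite xE (nxtE _ _ _ erefl) in ux.
  (* The cycle follows [p1] from [u] to its end, takes the chord to [v], runs back along the path to
     [x'], and returns to [u] by the other chord. *)
  apply: nham; exists (u :: p1 ++ rev (x' :: p2)); last first.
    by rewrite -szp /= !size_cat size_rev.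
  apply/andP; split; last first.
    move: Up; rewrite -[_ && _]/(uniq (u :: p1 ++ x' :: p2)) -!cat_cons !cat_uniq rev_uniq.
    by rewrite (eq_has_r (mem_rev _)).
  rewrite /= rcons_cat cat_path P1 /= rcons_path rev_cons last_rcons.
  rewrite [adj _ x' u]adj_sym ux andbT -rev_cons lastI rev_rcons /=.
  rewrite adj_sym vy /= -[path _ _ _]/(path (adj G) (last x' p2) (rev (belast x' p2))).
  by rewrite (eq_path (e' := fun z => (adj G)^~ z)) ?rev_path // => z w; apply: adj_sym.
(* [next] is cyclic, so only [v] has [u] as successor, and [v] is not its own neighbour. *)
have uB : u \notin B.
  apply/negP => /imsetP[y]; rewrite inE => vy uE.
  move: (inp y) vy uE Gp Up szp nxtE; rewrite /v; case/splitPl => p1 p2 <-.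
  rewrite last_cat; case: p2 => [|x' p2] /=; first by rewrite adj_irrefl.
  move=> _ uE _ /andP[up _] _ /(_ _ _ _ erefl) x'E.
  by move: up; rewrite uE x'E mem_cat mem_head orbT.
have : [set x | adj G u x] :|: B \subset ~: [set u].
  apply/subsetP => x; rewrite !inE => /orP[ux|xB].
    by apply: contraTneq ux => ->; rewrite adj_irrefl.
  by apply: contraNneq uB => <-.
move=> /subset_leq_card; rewrite cardsU (eqP (_ : _ :&: B == set0)) ?setI_eq0 //.
rewrite cards0 subn0 cB cardsC1 => le1.
rewrite (leq_ltn_trans le1) // prednK //.
by apply/card_gt0P; exists u.
Qed.

(** A Hamiltonian cycle of the augmented graph must use the new edge; deleting it leaves a
    Hamiltonian path of [G] with ends [u] and [v]. *)
Lemma deg_sum_add_edge (V : finType) (G : sgraph V) (u v : V) (uv : u != v) :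
    2 < #|V| -> ~ hamiltonian G -> hamiltonian (add_edge G uv) ->
  deg G u + deg G v < #|V|.
Proof.
move=> V3 nham [c /andP[cc Uc] szc].
have uc : u \in c by apply: mem_full_uniq.
have [i q qE] := rot_to uc.
move: cc Uc szc; rewrite -(rot_cycle i) -(rot_uniq i) -(size_rot i) qE.
case: q {qE} => [|w q] /=; first by move=> _ _ h; rewrite -h in V3.
move=> /andP[uw]; rewrite rcons_path => /andP[wq zu] /andP[uq Uq] szq.
rewrite add_edge_path // in wq.
have wu : w != u by apply: contraNneq uq => ->; apply: mem_head.
have zu' : last w q != u.
  by apply: contraNneq uq => <-; apply: mem_last.
move: uw; rewrite /add_edge_adj eqxx (negbTE uv) (negbTE wu) /= orbF => uw.
move: zu; rewrite /add_edge_adj /= eqxx (negbTE zu') andbT /= => zu.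
(* On the cycle [w] follows [u] and [last w q] precedes it, so the new edge is used only if one of
   them is [v]. *)
have [wv|wv] := eqVneq w v; last first.
  rewrite (negbTE wv) orbF in uw.
  have [zv|zv] := eqVneq (last w q) v; last first.
    rewrite (negbTE zv) orbF in zu.
    case: nham; exists [:: u, w & q] => //; apply/andP; split.
      by rewrite /= uw rcons_path wq zu.
    by rewrite /= uq.
  rewrite -zv; apply: (@deg_sum_ham_path _ _ u (w :: q)) => //=.
    by rewrite uw.
  by rewrite uq.
rewrite wv in uw wq uq Uq zu zu' *; rewrite addnC.
(* With at least three vertices, [v] cannot both follow and precede [u]. *)
have zv : last v q != v.
  move: szq Uq; case: (lastP q) => [/= h|q' z _]; first by rewrite -h in V3.
  rewrite last_rcons /= => /andP[+ _]; apply: contraNneq => ->.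
  by rewrite mem_rcons mem_head.
rewrite (negbTE zv) orbF in zu.
rewrite -[u in deg _ v + deg _ u](last_rcons v q).
apply: deg_sum_ham_path => //.
- by rewrite rcons_path wq.
- by rewrite -rcons_cons rcons_uniq uq.
- by rewrite -rcons_cons size_rcons.
Qed.

Lemma complete_hamiltonian (V : finType) (G : sgraph V) :
  1 < #|V| -> (forall x y, x != y -> adj G x y) -> hamiltonian G.
Proof.
move=> V2 Gc; exists (enum V); last by rewrite -cardE.
rewrite /ucycle enum_uniq andbT.
move: (enum_uniq V) V2; rewrite cardE; case: (enum V) => // x p /= /andP[xp Up] p1.
have H : forall y q, uniq (y :: q) -> path (adj G) y q.
  move=> y q; elim: q y => //= z q IH y /andP[yz Uz]; rewrite IH // andbT.
  by apply: Gc; apply: contraNneq yz => ->; apply: mem_head.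
rewrite rcons_path H /= ?xp //; apply: Gc.
by apply: contraNneq xp => <-; case: (p) p1 => //= z q _; apply: mem_last.
Qed.

(** Induction on the number of nonadjacent pairs. A nonadjacent pair of maximal degree sum is
    joined. If no Hamiltonian cycle appears, the counts pass down to [G], since adding an edge never
    lowers a degree. Otherwise the degree sum is below the order, and [k] is the smaller degree. *)
Theorem chvatal (V : finType) (G : sgraph V) :
    2 < #|V| -> (forall x, 0 < deg G x) -> ~ hamiltonian G ->
  exists k, [/\ 0 < k, 2 * k < #|V|, k <= #|[set x | deg G x <= k]|
    & #|V| - k <= #|[set x | deg G x < #|V| - k]|].
Proof.
move=> V3.
pose nonadj (H : sgraph V) := [set p : V * V | (p.1 != p.2) && ~~ adj H p.1 p.2].
have [m] := ubnP #|nonadj G|.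
elim: m => // m IH in G *; rewrite ltnS => leM dG nham.
have [M0|[p0 p0M]] := set_0Vmem (nonadj G).
  case: nham; apply: complete_hamiltonian; first exact: ltnW.
  move=> x y xy; have := in_set0 (x, y); rewrite -M0 inE /= xy /=.
  by move/negbFE.
case: (@arg_maxnP _ p0 [in nonadj G] (fun p => deg G p.1 + deg G p.2) p0M).
move=> [u0 v0] uvM0 maxM0.
have [u [v [uvM maxM leuv]]] : exists u v, [/\ (u, v) \in nonadj G,
    forall x y, (x, y) \in nonadj G -> deg G x + deg G y <= deg G u + deg G v
    & deg G u <= deg G v].
  have [le|/ltnW le] := leqP (deg G u0) (deg G v0).
    by exists u0, v0; split => // x y /maxM0.
  exists v0, u0; split => //; first by move: uvM0; rewrite !inE eq_sym adj_sym.
  by move=> x y /maxM0; rewrite /= [leqRHS]addnC.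
have /andP[/= uv nuv] : (u != v) && ~~ adj G u v by move: uvM; rewrite inE.
have [ham'|nham'] := EM (hamiltonian (add_edge G uv)); last first.
  have [||k [k0 k2 kL kM]] := IH (add_edge G uv) _ _ nham'.
  - apply: leq_trans leM; apply/proper_card/properP; split.
      by apply/subsetP => -[x y]; rewrite !inE /= /add_edge_adj negb_or
         => /and3P[-> -> _].
    by exists (u, v) => //; rewrite !inE /= /add_edge_adj !eqxx orbT andbF.
  - by move=> x; apply: leq_trans (dG x) (deg_add_edge G uv x).
  exists k; split => //.
    apply: leq_trans kL _; apply/subset_leq_card/subsetP => x; rewrite !inE.
    exact: leq_trans (deg_add_edge G uv x).
  apply: leq_trans kM _; apply/subset_leq_card/subsetP => x; rewrite !inE.
  exact: leq_ltn_trans (deg_add_edge G uv x).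
have ltN := deg_sum_add_edge V3 nham ham'.
(* By maximality, the vertices other than [v] not adjacent to [v] have degree at most [deg G u], and
   those not adjacent to [u] have degree at most [deg G v < #|V| - deg G u]. Counting both sets
   gives the claim. *)
exists (deg G u); split => //.
- by apply: leq_ltn_trans ltN; rewrite mul2n -addnn leq_add2l.
- apply: (@leq_trans #|~: (v |: [set y | adj G v y])|).
    rewrite cardsCs setCK cardsU1 inE adj_irrefl -/(deg G v) add1n; lia.
  apply/subset_leq_card/subsetP => x; rewrite !inE negb_or => /andP[xv nvx].
  by rewrite -(leq_add2r (deg G v)) maxM // inE /= xv adj_sym.
- apply: (@leq_trans #|~: [set y | adj G u y]|).
    by rewrite cardsCs setCK -/(deg G u).
  apply/subset_leq_card/subsetP => x; rewrite !inE => nux.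
  have [->|xu] := eqVneq x u.
    by rewrite ltn_subRL; apply: leq_ltn_trans ltN; rewrite leq_add2l.
  have : deg G u + deg G x <= deg G u + deg G v.
    by apply: maxM; rewrite inE /= eq_sym xu.
  by rewrite leq_add2l => /leq_ltn_trans -> //; rewrite ltn_subRL.
Qed.

End Chvatal.

(** * A Hamiltonian path as a spanning tree, and its leaf distance *)

Section PathTree.
Local Open Scope nat_scope.
Variables (V : finType) (s : seq V).

(** Adjacency is read off positions in [s], so that the tree properties become arithmetic on
    indices. *)
Definition path_adj (x y : V) : bool :=
  (index x s == (index y s).+1) || (index y s == (index x s).+1).

Lemma path_adj_sym : symmetric path_adj.
Proof. by move=> x y; rewrite /path_adj orbC. Qed.

Lemma path_adj_irrefl : irreflexive path_adj.
Proof. by move=> x; rewrite /path_adj orbb; apply/negbTE; lia. Qed.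

Definition path_graph : sgraph V := SGraph path_adj_sym path_adj_irrefl.

Hypotheses (Us : uniq s) (szs : size s = #|V|).

Lemma mem_path_graph x : x \in s.
Proof. exact: mem_full_uniq. Qed.

Lemma index_path_lt x : index x s < #|V|.
Proof. by rewrite -szs index_mem mem_path_graph. Qed.

Lemma index_path_inj x y : index x s = index y s -> x = y.
Proof.
by move=> h; rewrite -(nth_index x (mem_path_graph x)) h nth_index // mem_path_graph.
Qed.

Lemma index_path_nth x0 i : i < #|V| -> index (nth x0 s i) s = i.
Proof. by rewrite -szs => h; rewrite index_uniq. Qed.

Lemma path_graph_subrel (G : sgraph V) :
  sorted (adj G) s -> subrel path_adj (adj G).
Proof.
move=> Gs.
have H x y : index y s == (index x s).+1 -> adj G x y.
  move=> /eqP h; have /(sortedP x) Gs' := Gs.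
  have := Gs' (index x s); rewrite -h szs index_path_lt => /(_ isT).
  by rewrite !nth_index // mem_path_graph.
by move=> x y /orP[/H|/H //]; rewrite adj_sym.
Qed.

Lemma path_graph_connected : 0 < #|V| -> connected path_graph.
Proof.
move=> V0; split => //.
have sc : connect_sym path_adj by apply: sym_connect_sym path_adj_sym.
case: (s) Us szs mem_path_graph index_path_nth => [|x0 s'] /= _ sz' _ nthE.
  by rewrite -sz' in V0.
pose f := nth x0 s.
suff H x : connect path_adj (f 0) x.
  by move=> x y; apply: connect_trans (H y); rewrite sc.
rewrite -(nth_index x0 (mem_path_graph x)) -/(f _).
elim: (index x s) (index_path_lt x) => // i IH lti.
apply: connect_trans (IH (ltnW lti)) _; apply: connect1.
by rewrite /path_adj !index_path_nth ?eqxx ?orbT // ltnW.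
Qed.

(* The vertex of a cycle with the largest index has both its neighbours in the
   cycle at the preceding index. *)
Lemma path_graph_acyclic : acyclic path_graph.
Proof.
move=> c /andP[cc Uc]; case: c cc Uc => // x1 c1 cc Uc.
case: (@arg_maxnP _ x1 [in x1 :: c1] (index^~ s) (mem_head _ _)) => x xc maxx.
have [i q qE] := rot_to xc.
have memq z : z \in x :: q -> z \in x1 :: c1 by rewrite -qE mem_rot.
move: cc Uc; rewrite -(rot_cycle i) -(rot_uniq i) -[size _](size_rot i) qE.
case: q memq {qE} => // w [//|z q] memq /= /andP[xw].
rewrite rcons_path => /andP[_ /= yx] /and3P[_ wq _].
have wc : index w s <= index x s.
  by apply: maxx; apply: memq; rewrite inE mem_head orbT.
have lc : last z q \in z :: q by apply: mem_last.
have yc : index (last z q) s <= index x s.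
  by apply: maxx; apply: memq; rewrite inE inE lc !orbT.
suff h : w = last z q by rewrite h lc in wq.
apply: index_path_inj; move: xw yx wc yc; rewrite /= /path_adj; lia.
Qed.

(** A vertex strictly inside the list has two neighbours, just before and just after it. *)
Lemma path_graph_leaf x : 1 < #|V| -> leaf path_graph x ->
  index x s = 0 \/ index x s = #|V|.-1.
Proof.
move=> V1 lx; have ltx := index_path_lt x.
have [->|i0] := eqVneq (index x s) 0; first by left.
have [->|i1] := eqVneq (index x s) #|V|.-1; first by right.
move: lx; rewrite /leaf /deg => /cards1P[z zE].
pose i := index x s.
have H j : j < #|V| -> (i == j.+1) || (j == i.+1) -> index z s = j.
  move=> jV ij; have : nth x s j \in [set y | adj path_graph x y].
    by rewrite inE /= /path_adj index_path_nth.
  by rewrite zE inE => /eqP<-; rewrite index_path_nth.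
have := H i.-1; have := H i.+1; rewrite /i; lia.
Qed.

Lemma path_graph_walk k x y :
  walk path_graph k x y -> index y s <= index x s + k.
Proof.
case/existsP => p /andP[+ /eqP<-]; rewrite -[k in _ + k](size_tuple p).
elim: {p}(tval p) x => [|z p IH] x /=; first by rewrite addn0.
case/andP=> xz /IH; move: xz; rewrite /path_adj; lia.
Qed.

(** Two distinct leaves are the two ends of the path, and each step of a walk changes the index by
    one. *)
Lemma path_graph_leaf_dist : 1 < #|V| -> #|V|.-1 <= leaf_dist path_graph.
Proof.
(* Both nested minima default to [#|V|], which satisfies the bound. *)
move=> V1; apply: (big_ind (fun d => #|V|.-1 <= d)); first lia.
  by move=> d1 d2 h1 h2; rewrite leq_min h1.
move=> [x y] /= /and3P[lx ly xy]; apply: (big_ind (fun d => #|V|.-1 <= d)).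
- lia.
- by move=> d1 d2 h1 h2; rewrite leq_min h1.
move=> k wk; have h1 := path_graph_walk wk.
(* [path_graph_walk] bounds the final index only from above, so the walk is also read backwards. *)
have /path_graph_walk h2 : walk path_graph k y x.
  case/existsP: wk => p /andP[xp /eqP yE].
  apply/existsP; exists (rev_tuple [tuple of belast x p]).
  rewrite -yE (eq_path (e' := fun z => (adj path_graph)^~ z)); last first.
    by move=> ? ?; apply: adj_sym.
  rewrite /= rev_path xp /=.
  by case: (tval p) => //= a q; rewrite rev_cons last_rcons.
have nxy : index x s <> index y s by move/index_path_inj/eqP; rewrite (negbTE xy).
have := path_graph_leaf V1 lx; have := path_graph_leaf V1 ly; lia.
Qed.

End PathTree.

Local Open Scope ring_scope.

(** * Eigenvalues of the signless Laplacian and the Collatz-Wielandt bound *)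

Section Spectrum.
Variable R : realType.

Section OneGraph.
Variables (V : finType) (G : sgraph V).

(** Row vectors indexed through [enum_val] are traded for functions on vertices; the degree term is
    spread over the neighbours as copies of [f x]. *)
Lemma signless_laplacian_eigenvalueP (a : R) :
  reflect (exists2 f : V -> R, (exists x, f x != 0)
             & forall x, \sum_(y | adj G x y) (f x + f y) = a * f x)
    (eigenvalue (signless_laplacian R G) a).
Proof.
have mulE (w : 'rV[R]_#|V|) (f : V -> R) :
    (forall i, w 0 i = f (enum_val i)) -> forall j,
    (w *m signless_laplacian R G) 0 j =
    \sum_(y | adj G (enum_val j) y) (f (enum_val j) + f y).
  move=> wf j; rewrite mulmxDr mxE mul_mx_diag !mxE big_split /=; congr (_ + _).
    by rewrite wf sumr_const mulr_natr /deg cardsE.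
  rewrite [RHS]big_mkcond /= [RHS](reindex _ (onW_bij _ (enum_val_bij V))) /=.
  apply: eq_bigr => i _.
  by rewrite mxE wf adj_sym; case: adj; rewrite ?mulr1 ?mulr0.
apply: (iffP eigenvalueP) => [[w wQ w0]|[f [x fx] fQ]].
  pose f x := w 0 (enum_rank x).
  have wf i : w 0 i = f (enum_val i) by rewrite /f enum_valK.
  exists f.
    have [i wi] : exists i, w 0 i != 0 by apply/rV0Pn.
    by exists (enum_val i); rewrite -wf.
  by move=> x; rewrite -(enum_rankK x) -(mulE w f wf) wQ mxE wf.
pose w : 'rV[R]_#|V| := \row_i f (enum_val i).
have wf i : w 0 i = f (enum_val i) by rewrite mxE.
exists w.
  by apply/rowP => j; rewrite (mulE w f wf) fQ mxE wf.
by apply/rV0Pn; exists (enum_rank x); rewrite wf enum_rankK.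
Qed.

Lemma eigenvalue_le_q_index (a : R) :
  eigenvalue (signless_laplacian R G) a -> a <= q_index R G.
Proof.
move=> Ea; have V0 : (0 < #|V|)%N.
  have /signless_laplacian_eigenvalueP[f [x _] _] := Ea.
  by apply/card_gt0P; exists x.
by have [_ ->] := largest_eigenvalueP V0 (signless_laplacian_sym R G).
Qed.

(* Collatz-Wielandt: look at the eigenvector where its ratio to [f] is largest. *)
Lemma q_index_lt (a : R) (f : V -> R) : (0 < #|V|)%N -> (forall x, 0 < f x) ->
  (forall x, \sum_(y | adj G x y) (f x + f y) < a * f x) -> q_index R G < a.
Proof.
move=> V0 f0 fa; rewrite ltNge; apply/negP => qa.
have [Eq _] := largest_eigenvalueP V0 (signless_laplacian_sym R G).
have /signless_laplacian_eigenvalueP[g [x0 gx0] gq] := Eq.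
set q := largest_eigenvalue _ in gq; have {}qa : a <= q by [].
case: (@Order.TotalTheory.arg_maxP _ _ _ x0 xpredT (fun x => `|g x| / f x) isT) => x _ maxx.
set r := `|g x| / f x in maxx.
have r0 : 0 < r.
  by apply: lt_le_trans (maxx x0 isT); rewrite divr_gt0 // normr_gt0.
have gle y : `|g y| <= r * f y by rewrite -ler_pdivrMr //; apply: maxx.
have gx : `|g x| = r * f x by rewrite divfK // gt_eqF.
have : q * `|g x| < q * `|g x|; last by rewrite ltxx.
have s0 : 0 <= \sum_(y | adj G x y) (f x + f y).
  by apply: sumr_ge0 => y _; rewrite addr_ge0 // ltW.
have q0 : 0 <= q.
  apply: le_trans qa; rewrite -(pmulr_lge0 _ (f0 x)).
  exact: le_trans (ltW (fa x)).
(* Triangle inequality at [x], where [|g|] equals [r * f], while [|g| <= r * f] everywhere. *)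
rewrite -[X in X * _ < _](ger0_norm q0) -normrM -gq.
apply: (@le_lt_trans _ _ (r * \sum_(y | adj G x y) (f x + f y))).
  rewrite mulr_sumr; apply: le_trans (ler_norm_sum _ _ _) _.
  by apply: ler_sum => y _; rewrite mulrDr -gx; apply: le_trans (ler_normD _ _) _; rewrite lerD2l.
rewrite gx mulrCA ltr_pM2l //; apply: lt_le_trans (fa x) _.
by rewrite ler_pM2r.
Qed.

End OneGraph.

(** * The quotient cubic and its link with the extremal graph *)

Section Cubic.
Variables n s x : R.

(* The characteristic polynomial of the quotient of the signless Laplacian of
   K_s v (K_(n-2s) U s K_1) by its three natural classes. *)
Definition quotient_poly : R :=
  (x - n - s + 2) * (x - 2 * n + 3 * s + 2) * (x - s)
  - s * (n - 2 * s) * (x - s) - s ^+ 2 * (x - 2 * n + 3 * s + 2).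

End Cubic.

(** Subtracting [P_t], which vanishes at [x], leaves a multiple of [s - t]. The cofactor is bounded
    below by its value at [x = 2 n - 2 t - 2], and this value is nonnegative since [2 s + 2 <= n]
    and [7 t + 1 <= n]. *)
Lemma quotient_poly_ge0 (n t s x : R) : 0 < t -> t <= s -> 2 * s + 2 <= n ->
  7 * t + 1 <= n -> 2 * n - 2 * t - 2 <= x -> quotient_poly n t x = 0 ->
  0 <= quotient_poly n s x.
Proof.
move=> t0 ts sn tn xn Pt.
have -> : quotient_poly n s x = (s - t) * ((x - n + 2) * (x + 2 * n - 2)
   - (s + t) * (4 * x - 4 * n + 6) - 2 * (s ^+ 2 + s * t + t ^+ 2)).
  by rewrite -[LHS]subr0 -Pt /quotient_poly; ring.
apply: mulr_ge0; first lra.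
have h1 : (n - 2 * t) * (4 * n - 2 * t - 4) - (s + t) * (4 * n - 8 * t - 2)
   - 2 * (s ^+ 2 + s * t + t ^+ 2) <= (x - n + 2) * (x + 2 * n - 2)
   - (s + t) * (4 * x - 4 * n + 6) - 2 * (s ^+ 2 + s * t + t ^+ 2).
  rewrite -subr_ge0.
  have -> : (x - n + 2) * (x + 2 * n - 2)
   - (s + t) * (4 * x - 4 * n + 6) - 2 * (s ^+ 2 + s * t + t ^+ 2) - 
   ((n - 2 * t) * (4 * n - 2 * t - 4) - (s + t) * (4 * n - 8 * t - 2)
   - 2 * (s ^+ 2 + s * t + t ^+ 2)) =
   (x - (2 * n - 2 * t - 2)) * (x + 3 * n - 2 * t - 2 - 4 * s - 4 * t).
    by ring.
  by apply: mulr_ge0; lra.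
apply: le_trans h1; nra.
Qed.

(** Intermediate value theorem between [2 n - 2 t - 2] and [2 n - 2]; the sign at the right end
    comes from [7 t + 1 <= n]. *)
Lemma quotient_poly_root (n t : R) : 0 < t -> 7 * t + 1 <= n ->
  exists2 x, 2 * n - 2 * t - 2 <= x & quotient_poly n t x = 0.
Proof.
move=> t0 tn.
pose p : {poly R} := ('X - (n + t - 2)%:P) * ('X - (2 * n - 3 * t - 2)%:P) * ('X - t%:P)
  - (t * (n - 2 * t))%:P * ('X - t%:P) - (t ^+ 2)%:P * ('X - (2 * n - 3 * t - 2)%:P).
have pE x : p.[x] = quotient_poly n t x.
  by rewrite /p !hornerE /quotient_poly; ring.
have [||x /andP[xl _] /rootP] := @poly_ivt _ p (2 * n - 2 * t - 2) (2 * n - 2).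
- lra.
- rewrite !pE; apply/andP; split.
    have -> : quotient_poly n t (2 * n - 2 * t - 2) = - (t ^+ 2 * (2 * n - 2 * t - 2)).
      by rewrite /quotient_poly; ring.
    by rewrite oppr_le0 mulr_ge0 ?sqr_ge0 //; lra.
  have -> : quotient_poly n t (2 * n - 2)
      = 2 * t * (2 * n * (n - (7 * t + 1)) + t * (12 * n + 1 - t)).
    by rewrite /quotient_poly; ring.
  by rewrite mulr_ge0 ?addr_ge0 ?mulr_ge0 //; lra.
by rewrite pE; exists x.
Qed.

(** The eigenvector is 1 on [K_t], [b] on [K_m] and [c] on the isolated vertices. The last two
    classes determine [b] and [c]; the equation on [K_t], cleared of denominators, is then the
    cubic. *)
Lemma eigenvalue_extremal (t m : nat) (x : R) : (0 < t)%N ->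
    let n := (m + 2 * t)%:R in
    2 * n - 2 * t%:R - 2 <= x -> t%:R < x -> quotient_poly n t%:R x = 0 ->
  eigenvalue (signless_laplacian R
    (join (complete t) (disjoint_union (complete m) (edgeless t)))) x.
Proof.
move=> t0 n xn tx Px.
have t0R : (0 : R) < t%:R by rewrite ltr0n.
pose b : R := t%:R / (x - 2 * n + 3 * t%:R + 2).
pose c : R := t%:R / (x - t%:R).
have bE : b * (x - 2 * n + 3 * t%:R + 2) = t%:R by rewrite divfK //; lra.
have cE : c * (x - t%:R) = t%:R by rewrite divfK //; lra.
have nE : n = m%:R + 2 * t%:R by rewrite /n natrD natrM.
have aE : (n + t%:R - 2) + (n - 2 * t%:R) * b + t%:R * c = x.
  have nz1 : x - 2 * n + 3 * t%:R + 2 != 0 by lra.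
  have nz2 : x - t%:R != 0 by lra.
  apply/eqP; rewrite -subr_eq0; apply/eqP.
  apply: (mulfI nz1); apply: (mulfI nz2); rewrite !mulr0 -[RHS]oppr0 -Px /quotient_poly.
  rewrite /b /c; by field; rewrite nz2 -nE nz1.
apply/signless_laplacian_eigenvalueP.
exists (fun z => match z with inl _ => 1 | inr (inl _) => b | inr (inr _) => c end).
  by exists (inl (Ordinal t0)); rewrite oner_neq0.
have pred1 k : (0 < k)%N -> (k.-1)%:R = k%:R - 1 :> R.
  by move=> k0; rewrite -subn1 natrB.
have mulE (y : R) k : y *+ k = y * k%:R by rewrite mulr_natr.
move=> [i|[i|i]]; rewrite !big_sumType /= ?big_pred0_eq !sumr_const.
- rewrite (eq_card (B := predC1 i)); last by move=> j; rewrite !inE eq_sym.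
  rewrite cardC1 !card_ord (mulE _ t.-1) (mulE _ m) (mulE _ t) pred1 //.
  by rewrite mulr1 -[RHS]aE nE; ring.
- rewrite [in X in _ + (X + _)](eq_card (B := predC1 i)); last by move=> j; rewrite !inE eq_sym.
  have m0 : (0 < m)%N by case: i; case: (m).
  rewrite cardC1 !card_ord (mulE _ t) (mulE _ m.-1) pred1 // addr0.
  by move: bE; rewrite nE => bE; lra.
- by rewrite !card_ord (mulE _ t) !addr0; lra.
Qed.

End Spectrum.

(** * From Hamiltonian cycles of the cone to Hamiltonian paths *)

Section HamiltonianPath.
Local Open Scope nat_scope.
Variables (V : finType) (G : sgraph V).

Let cone := join G (complete 1).

Lemma card_cone : #|{: V + 'I_1}| = #|V|.+1.
Proof. by rewrite card_sum card_ord addn1. Qed.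

Lemma deg_cone_inl x : deg cone (inl x) = (deg G x).+1.
Proof.
rewrite /deg -!sum1dep_card big_sumType /= sum1dep_card.
by rewrite big_const_ord /= addn0 addn1.
Qed.

Lemma deg_cone_inr i : deg cone (inr i) = #|V|.
Proof.
rewrite /deg -!sum1dep_card big_sumType /= sum1_card big1 ?addn0 // => j.
by rewrite !ord1 eqxx.
Qed.

Lemma hamiltonian_cone_path : hamiltonian cone ->
  exists s, [/\ uniq s, size s = #|V| & sorted (adj G) s].
Proof.
move=> [c /andP[cc Uc] szc]; rewrite card_cone in szc.
have oc : inr ord0 \in c by apply: mem_full_uniq; rewrite ?card_cone.
have [i q qE] := rot_to oc.
move: cc Uc szc; rewrite -(rot_cycle i) -(rot_uniq i) -(size_rot i) qE.
rewrite [cycle _ _]/= [size _]/= cons_uniq => qc /andP[oq Uq] [szq].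
have [s sE] : exists s, q = map inl s.
  elim: {qE qc Uq szq} q oq => [|[x|j] q IH]; first by exists [::].
    by rewrite inE => /IH[s ->]; exists (x :: s).
  by rewrite inE !ord1 eqxx.
exists s; move: qc szq Uq; rewrite sE size_map => qc -> /map_uniq ->; split => //.
move: qc; rewrite rcons_path => /andP[/path_sorted + _].
by rewrite sorted_map.
Qed.

Lemma ham_path_or_low_degrees t : 1 < #|V| -> (forall x, t <= deg G x) ->
  (exists s, [/\ uniq s, size s = #|V| & sorted (adj G) s]) \/
  exists s, [/\ t <= s, 2 * s + 2 <= #|V|, s + 1 <= #|[set x | deg G x <= s]|
    & #|V| - s <= #|[set x | deg G x + s + 2 <= #|V|]|].
Proof.
move=> V1 tG; have [/hamiltonian_cone_path|nham] := EM (hamiltonian cone); [by left|right].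
have [||k] := @chvatal _ cone _ _ nham.
- by rewrite card_cone.
- by move=> [x|i]; rewrite ?deg_cone_inl ?deg_cone_inr // ltnW.
(* The cone raises the order and the degrees in [G] by one, hence the shift [k = s + 1]. *)
case: k => [[] //|s]; rewrite card_cone => -[_ s2 sL sM].
(* The apex, of degree [#|V|], lies in neither degree class, so both counts descend to [G]. *)
have cardP (e : pred (V + 'I_1)) (e' : pred V) :
    ~~ e (inr ord0) -> (forall x, e (inl x) -> e' x) ->
    #|[set z | e z]| <= #|[set x | e' x]|.
  move=> e0 ee'; apply: leq_trans (leq_imset_card inl _).
  apply/subset_leq_card/subsetP => -[x|i]; rewrite inE.
    by move=> ex; apply: imset_f; rewrite inE ee'.
  by rewrite ord1 (negbTE e0).
have sL' : s.+1 <= #|[set x | deg G x <= s]|.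
  apply: leq_trans sL _; apply: cardP => [|x]; last by rewrite deg_cone_inl.
  rewrite deg_cone_inr -ltnNge; lia.
exists s; split.
- have /card_gt0P[x] : 0 < #|[set x | deg G x <= s]| by apply: leq_trans sL'.
  by rewrite inE; apply: leq_trans.
- lia.
- by rewrite addn1.
rewrite -subSS; apply: leq_trans sM _; apply: cardP => [|x].
  by rewrite deg_cone_inr; lia.
by rewrite deg_cone_inl; lia.
Qed.

End HamiltonianPath.

(** * An upper bound on [q(G)] from the two degree counts *)

Lemma subset_card_between (T : finType) (A B : {set T}) k :
  A \subset B -> (#|A| <= k <= #|B|)%N ->
  exists C : {set T}, [/\ A \subset C, C \subset B & #|C| = k].
Proof.
move=> AB /andP[Ak kB].
have /card_geqP[s [Us szs sBA]] : (k - #|A| <= #|B :\: A|)%N.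
  by rewrite cardsDS // leq_sub2r.
exists (A :|: [set x in s]); split; first exact: subsetUl.
  rewrite subUset AB; apply/subsetP => x; rewrite inE => /sBA.
  by rewrite inE => /andP[].
rewrite cardsU (_ : _ :&: _ = set0) ?cards0 ?subn0; last first.
  apply/setP => x; rewrite !inE; apply/negbTE/negP => /andP[xA /sBA].
  by rewrite inE xA.
by rewrite cardsE (card_uniqP Us) szs subnKC.
Qed.

Section DegreeBound.
Variables (R : realType) (V : finType) (G : sgraph V).

(** The test vector is 1 on the [s] vertices outside [W], [b] on [W] minus [L], and [c'] on [L].
    Compared with the extremal pattern for [s], one vertex has moved from the class of [b] to the
    lowest class. *)
Lemma q_index_lt_low_degrees (s : nat) (x : R) :
    let n : R := #|V|%:R in
    (0 < s)%N -> (2 * s + 2 <= #|V|)%N ->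
    (s + 1 <= #|[set y | (deg G y <= s)%N]|)%N ->
    (#|V| - s <= #|[set y | (deg G y + s + 2 <= #|V|)%N]|)%N ->
    2 * n - 2 * s%:R - 2 <= x -> 0 <= quotient_poly n s%:R x ->
  q_index R G < x.
Proof.
move=> n s0 sn cL cW xn Px.
have sV : (s <= #|V|)%N by lia.
have V0 : (0 < #|V|)%N by lia.
have sn' : 2 * s%:R + 2 <= n by rewrite -natrM -natrD ler_nat.
have s0' : (0 : R) < s%:R by rewrite ltr0n.
have [|L [_ /subsetP Ldeg cardL]] := @subset_card_between _ set0
    [set y | (deg G y <= s)%N] (s + 1) (sub0set _).
  by rewrite cards0 cL.
have [||W [LW /subsetP Wdeg cardW]] := @subset_card_between _ L
    [set y | (deg G y + s + 2 <= #|V|)%N] (#|V| - s).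
- by apply/subsetP => y /Ldeg; rewrite !inE; lia.
- by rewrite cW cardL andbT; lia.
pose b : R := s%:R / (x - 2 * n + 3 * s%:R + 2).
pose c : R := s%:R / (x - s%:R).
(* The inequality on [L] needs [c < c'], and the one outside [W] needs [(s + 1) (c' - c) < b - c];
   dividing by [s + 2] meets both. *)
pose c' : R := c + (b - c) / (s%:R + 2).
have bE : b * (x - 2 * n + 3 * s%:R + 2) = s%:R by rewrite divfK //; lra.
have cE : c * (x - s%:R) = s%:R by rewrite divfK //; lra.
have b0 : 0 < b by rewrite divr_gt0 //; lra.
have c0 : 0 < c by rewrite divr_gt0 //; lra.
have b1 : b <= 1 by rewrite ler_pdivrMr; lra.
have cb : c < b.
  rewrite -(@ltr_pM2r _ (x - s%:R)); last lra.
  by rewrite cE; nra.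
have c'E : (c' - c) * (s%:R + 2) = b - c by rewrite /c' addrC addKr divfK //; lra.
have cc' : c < c' by rewrite /c' ltrDl divr_gt0 //; lra.
have c'b : c' <= b by nra.
(* This is [0 <= P_s(x)] divided by two positive denominators. *)
have aE : (n + s%:R - 2) + (n - 2 * s%:R) * b + s%:R * c <= x.
  have D0 : 0 < (x - 2 * n + 3 * s%:R + 2) * (x - s%:R) by apply: mulr_gt0; lra.
  rewrite -subr_ge0 -(pmulr_rge0 _ D0).
  suff -> : (x - 2 * n + 3 * s%:R + 2) * (x - s%:R)
     * (x - ((n + s%:R - 2) + (n - 2 * s%:R) * b + s%:R * c)) = quotient_poly n s%:R x.
    by [].
  rewrite /quotient_poly /b /c; field; apply/andP; split; lra.
clearbody c'; clearbody b c.
pose f y : R := 1 + (if y \in W then b - 1 else 0) + (if y \in L then c' - b else 0).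
have fL y : y \in L -> f y = c'.
  by move=> yL; rewrite /f yL (subsetP LW) //; ring.
have fW y : y \in W -> y \notin L -> f y = b.
  by move=> yW /negbTE yL; rewrite /f yW yL; ring.
have fH y : y \notin W -> f y = 1.
  move=> yW; rewrite /f (negbTE yW) ifN; first ring.
  by apply: contra yW; apply: subsetP.
have f_le y : f y <= b + (if y \in ~: W then 1 - b else 0).
  rewrite inE; have [yL|yL] := boolP (y \in L).
    by rewrite fL // (subsetP LW) //= addr0.
  by have [yW|yW] := boolP (y \in W); [rewrite fW //= addr0 | rewrite fH //=; lra].
have f_le1 y : f y <= 1 by apply: le_trans (f_le y) _; case: ifP; lra.
have sum_if (A : {set V}) (r : R) : \sum_y (if y \in A then r else 0) = r * #|A|%:R.
  by rewrite -big_mkcond sumr_const mulr_natr.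
have natW : (#|W|)%:R = n - s%:R by rewrite cardW natrB.
have natWC : (#|~: W|)%:R = s%:R :> R by rewrite cardsCs setCK cardW subKn.
have natL : (#|L|)%:R = s%:R + 1 :> R by rewrite cardL natrD.
have sum_f : \sum_y f y = s%:R + (n - 2 * s%:R - 1) * b + (s%:R + 1) * c'.
  rewrite /f !big_split /= !sum_if sumr_const -[_ *+ _]/n natW natL; ring.
clearbody f.
have sum_const y (r : R) : \sum_(z | adj G y z) r = r * (deg G y)%:R.
  by rewrite sumr_const mulr_natr /deg cardsE.
apply: (@q_index_lt _ _ _ x f) => //.
  move=> y; have [yL|yL] := boolP (y \in L); first by rewrite fL //; lra.
  by have [yW|yW] := boolP (y \in W); [rewrite fW | rewrite fH].
move=> y; have [yL|yL] := boolP (y \in L).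
  apply: (@le_lt_trans _ _ (\sum_(z | adj G y z) (c' + 1))).
    by apply: ler_sum => z _; rewrite fL // lerD2l.
  rewrite sum_const fL //; apply: (@le_lt_trans _ _ ((c' + 1) * s%:R)).
    by apply: ler_wpM2l; [lra | rewrite ler_nat; have := Ldeg _ yL; rewrite inE].
  rewrite -subr_gt0; have -> : x * c' - (c' + 1) * s%:R
     = (c' - c) * (x - s%:R) + (c * (x - s%:R) - s%:R) by ring.
  by rewrite cE subrr addr0 mulr_gt0 //; lra.
have [yW|yW] := boolP (y \in W).
  (* Every neighbour counts as [b], with an excess [1 - b] for each of the [s] vertices outside
     [W]. *)
  rewrite fW //; apply: (@le_lt_trans _ _
    (\sum_(z | adj G y z) (2 * b) + \sum_z (if z \in ~: W then 1 - b else 0))).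
    rewrite [X in _ <= _ + X](bigID (adj G y)) /= addrA -big_split /=.
    apply: ler_wpDr; first by apply: sumr_ge0 => z _; case: ifP; lra.
    by apply: ler_sum => z _; rewrite mulr_natl mulr2n -addrA lerD2l.
  rewrite sum_const sum_if natWC.
  have dy : (deg G y)%:R <= n - s%:R - 2.
    have := Wdeg _ yW; rewrite inE -(ler_nat R) !natrD -/n; lra.
  apply: (@le_lt_trans _ _ (2 * b * (n - s%:R - 2) + (1 - b) * s%:R)).
    by rewrite lerD2r ler_wpM2l //; lra.
  lra.
(* No degree bound is known here, so all other vertices are counted as neighbours. *)
rewrite fH // mulr1; apply: (@le_lt_trans _ _ (\sum_(z | z != y) (1 + f z))).
  rewrite [leRHS](bigID (adj G y)) /=; apply: ler_wpDr.
    apply: sumr_ge0 => z _; have [zL|zL] := boolP (z \in L); first by rewrite fL //; lra.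
    by have [zW|zW] := boolP (z \in W); [rewrite fW //; lra | rewrite fH //; lra].
  rewrite le_eqVlt; apply/orP; left; apply/eqP; apply: eq_bigl => z.
  have [yz|] := boolP (adj G y z); last by rewrite andbF.
  by rewrite andbT; apply/esym; apply: contraTneq yz => ->; rewrite adj_irrefl.
have tot : \sum_z (1 + f z) = n + (s%:R + (n - 2 * s%:R - 1) * b + (s%:R + 1) * c').
  by rewrite big_split /= sum_f sumr_const.
move: tot; rewrite (bigD1 y) //= fH // => tot.
have : (s%:R + 1) * (c' - c) < b - c by rewrite -c'E; lra.
lra.
Qed.

End DegreeBound.

(** * The dichotomy: a Hamiltonian path, or [q(G)] below the extremal value *)

Lemma min_deg_le (V : finType) (G : sgraph V) x : (min_deg G <= deg G x)%N.
Proof.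
rewrite /min_deg; elim: (index_enum V) (mem_index_enum x) => // y r IH.
rewrite inE big_cons geq_min => /predU1P[->|/IH ->]; first by rewrite leqnn.
by rewrite orbT.
Qed.

Theorem theorem1p9 (R : realType) (t n : nat) (V : finType) (G : sgraph V)
    (t_gt0 : (0 < t)%N)
    (G_connected : connected G)
    (G_order : #|V| = n)
    (n_ge : (7 * t + 1 <= n)%N)
    (G_min_deg : (t <= min_deg G)%N)
    (G_q_index :
       q_index R (join (complete t)
                       (disjoint_union (complete (n - 2 * t)) (edgeless t)))
         <= q_index R G) :
  exists T : sgraph V, spanning_tree G T /\ (4 <= leaf_dist T)%N.
Proof.
have V8 : (7 < #|V|)%N by lia.
have tG x : (t <= deg G x)%N.
  exact: leq_trans G_min_deg (min_deg_le G x).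
have [|[s [Us szs Gs]]|[s [ts sn sL sW]]] := ham_path_or_low_degrees _ tG; first lia.
  exists (path_graph s); split; last first.
    by apply: leq_trans (path_graph_leaf_dist Us szs _); lia.
  split; last exact: path_graph_subrel.
  split; last exact: path_graph_acyclic.
  by apply: path_graph_connected => //; lia.
exfalso; move: G_q_index; apply/negP; rewrite -ltNge.
have t0 : (0 : R) < t%:R by rewrite ltr0n.
have tn : 7 * t%:R + 1 <= n%:R :> R.
  by move: n_ge; rewrite -(ler_nat R) natrD natrM.
have tsR : t%:R <= s%:R :> R by rewrite ler_nat.
have snR : 2 * s%:R + 2 <= n%:R :> R by rewrite -natrM -natrD ler_nat -G_order.
have [x xn Px] := quotient_poly_root t0 tn.
have nE : (n - 2 * t + 2 * t = n)%N by lia.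
(* The root [x] of [P_t] separates the two indices: it lies strictly above [q(G)] and is an
   eigenvalue of the extremal graph. *)
apply: (@lt_le_trans _ _ x).
  apply: (q_index_lt_low_degrees _ sn sL sW); rewrite ?G_order; first lia.
    lra.
  exact: (quotient_poly_ge0 t0 tsR snR tn xn Px).
apply: eigenvalue_le_q_index; apply: eigenvalue_extremal => //=; rewrite ?nE //; lra.
Qed.
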